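(* Let $N\ge1$, let $\beta_1,\beta_2,\alpha_1,\dots,\alpha_N$ be real and let $x_1,\dots,x_N$ be nonzero real numbers. Let $e_k(1)$ be the coefficients of the polynomial $$W(t)=(\beta_1+1)(1-t)\prod_{j=1}^N(1-x_jt)-(\beta_2+1)\,t\prod_{j=1}^N(1-x_jt)-\sum_{l=1}^N(\alpha_l+1)x_l\,t(1-t)\prod_{j\ne l}(1-x_jt)$$ expanded in powers of $u=1-t$, i.e. $W(t)=\sum_{k=0}^{N+1}e_k(1)u^k$. Then for $k=0,\dots,N+1$, $$e_k(1)=x_1\cdots x_N\left[(\beta_1+1)v_k(1)+(\beta_2+1)w_k(1)+\sum_{l=1}^N(\alpha_l+1)x_l\,z_{k,l}(1)\right],$$ where $$v_k(1)=\sigma_{N+1-k}\Bigl(\bigl(\tfrac{1-x_j}{x_j}\bigr)_{j=1,\dots,N}\Bigr),$$ $$w_k(1)=\sigma_{N+1-k}\Bigl(\bigl(\tfrac{1-x_j}{x_j}\bigr)_{j=1,\dots,N}\Bigr)-\sigma_{N-k}\Bigl(\bigl(\tfrac{1-x_j}{x_j}\bigr)_{j=1,\dots,N}\Bigr),$$ $$z_{k,l}(1)=\sigma_{N+1-k}\Bigl(\bigl(\tfrac{1-x_j}{x_j}\bigr)_{j\ne l}\Bigr)-\sigma_{N-k}\Bigl(\bigl(\tfrac{1-x_j}{x_j}\bigr)_{j\ne l}\Bigr).$$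
   Context: $\sigma_l(y_1,\dots,y_k)$ is the $l$-th elementary symmetric polynomial in $k$ variables, with $\sigma_0=1$ (also for $k=0$) and $\sigma_l=0$ if $l<0$ or $l>k$.
   Formalization: The factor x_l before z_{k,l}(1) in the formula for e_k(1) is dropped, since it is already absorbed in x_1...x_N; as printed the formula fails for N=1, beta_1=beta_2=-1, alpha_1=0, x_1=2, where e_1(1)=-2 but the formula gives -4. *)

(* Defs.v *)
From HB Require Import structures.
From mathcomp Require Import all_boot all_order all_algebra.
From mathcomp Require Import reals.
From mathcomp Require Import mpoly.

Set Implicit Arguments.
Unset Strict Implicit.
Unset Printing Implicit Defensive.

Import Order.TTheory GRing.Theory Num.Theory.
Local Open Scope ring_scope.

Section Defs.
Variable R : realType.

(* [sigma l y] is the l-th elementary symmetric polynomial at y_1, ..., y_n.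
   The degree l is an integer: [Negz] is the case l < 0, and [mesym] already
   vanishes for l > n. *)
Definition sigma (n : nat) (l : int) (y : 'I_n -> R) : R :=
  match l with
  | Posz m => (mesym n R m).@[y]
  | Negz _ => 0
  end.

Variable N : nat.
Implicit Types x a : 'I_N -> R.

Definition Wpoly b1 b2 a x : {poly R} :=
  (b1 + 1) *: ((1 - 'X) * \prod_(j < N) (1 - x j *: 'X))
  - (b2 + 1) *: ('X * \prod_(j < N) (1 - x j *: 'X))
  - \sum_(l < N) ((a l + 1) * x l) *:
      ('X * (1 - 'X) * \prod_(j < N | j != l) (1 - x j *: 'X)).

Definition shifted_inv x (j : 'I_N) : R := (1 - x j) / x j.

(* In N%:Z + 1 - k%:Z and N%:Z - k%:Z the subtraction is that of int, so that
   the second one is -1 for k = N + 1. *)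
Definition v1 x (k : nat) : R := sigma (N%:Z + 1 - k%:Z) (shifted_inv x).

Definition w1 x (k : nat) : R :=
  sigma (N%:Z + 1 - k%:Z) (shifted_inv x) - sigma (N%:Z - k%:Z) (shifted_inv x).

(* [lift l : 'I_N.-1 -> 'I_N] enumerates the indices j != l.
   The factor x_l in the l-th term of [Wpoly] combines with the product of the
   x_j, j != l, into x_1 ... x_N, so that term contributes
   (a_l + 1) * (x_1 ... x_N) * z1 x k l to the coefficient of (1 - t)^k, with
   no further factor x_l. *)
Definition z1 x (k : nat) (l : 'I_N) : R :=
  sigma (N%:Z + 1 - k%:Z) (fun j : 'I_N.-1 => shifted_inv x (lift l j))
  - sigma (N%:Z - k%:Z) (fun j : 'I_N.-1 => shifted_inv x (lift l j)).

End Defs.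

(* Main.v *)
Require Import Defs.
From mathcomp Require Import all_boot all_order all_algebra.
From mathcomp Require Import reals.
From mathcomp Require Import mpoly.
From mathcomp Require Import ring.

Import Order.TTheory GRing.Theory Num.Theory.
Local Open Scope ring_scope.

(** Substituting [1 - 'X] for ['X] turns the expansion of [W] in powers of
    [u = 1 - t] into the ordinary expansion of a polynomial in [u], so [e k] is
    a plain coefficient of [Wpoly b1 b2 a x \Po (1 - 'X)].  Under [t = 1 - u]
    a factor becomes
      [1 - x_j t = (1 - x_j) + x_j u = x_j (u + s_j)], [s_j = (1 - x_j) / x_j],
    and, [P] being the product of all the [x_j], the three parts of [W], taken
    with their signs, become
      [(b1 + 1) P u \prod_j (u + s_j)],
      [(b2 + 1) P (u - 1) \prod_j (u + s_j)],
      [(a_l + 1) P (u ^ 2 - u) \prod_(j != l) (u + s_j)];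
    in the last one the factor [x_l] standing in [W] completes the product of
    the other [x_j] to [P] ([Wpoly_comp]).  The coefficients of a product of
    [n] factors [u + y_j] are elementary symmetric polynomials, and multiplying
    by [u ^ m] only shifts them ([coef_XnM_prodXD]): the coefficient of [u ^ k]
    is [sigma (n + m - k) y].  Reading this off with [n = N] and [m = 1, 0], and
    with [n = N - 1] and [m = 2, 1], gives [v1], [w1] and [z1]. *)

Lemma meval_mesym (R : comNzRingType) (n k : nat) (y : 'I_n -> R) :
  (mesym n R k).@[y] = \sum_(h : {set 'I_n} | #|h| == k) \prod_(i in h) y i.
Proof.
rewrite /mesym raddf_sum /=; apply: eq_bigr => h _.
by rewrite rmorph_prod /=; apply: eq_bigr => i _; rewrite mevalXU.
Qed.

(** Choosing [y j] in the factors [j \in J] and ['X] in the others contributes to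
    ['X^(n - #|J|)]; as [#|J| <= n], the sets contributing to degree [i <= n] are
    exactly those of cardinality [n - i]. *)
Lemma coef_prodXD (R : realType) (n : nat) (y : 'I_n -> R) (i : nat) :
  (\prod_(j < n) ('X + (y j)%:P))`_i = sigma (n%:Z - i%:Z) y.
Proof.
under eq_bigr do rewrite addrC.
rewrite bigA_distr coef_sum /=.
have coefJ (J : {set 'I_n}) :
    (\prod_j (if j \in J then (y j)%:P else 'X))`_i
    = if (i + #|J| == n)%N then \prod_(j in J) y j else 0.
  have le_Jn : (#|J| <= n)%N by rewrite -[leqRHS]card_ord max_card.
  rewrite (bigID (mem J)) /= (eq_bigr (fun j => (y j)%:P)); last first.
    by move=> j ->.
  rewrite [X in _ * X](eq_bigr (fun=> 'X)); last by move=> j /negbTE ->.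
  rewrite -rmorph_prod prodr_const coefCM coefXn.
  have -> : #|(fun j => j \notin J)| = (n - #|J|)%N.
    by apply/(canRL (addKn _)); rewrite (cardC (mem J)) card_ord.
  rewrite -(eqn_add2r #|J|) subnK //.
  by case: eqP => _; rewrite (mulr1, mulr0).
rewrite (eq_bigr _ (fun J _ => coefJ J)) -big_mkcond /=.
have [le_in | lt_ni] := leqP i n.
  rewrite subzn //= meval_mesym; apply: eq_bigl => J.
  by rewrite -[RHS](eqn_add2l i) subnKC.
rewrite big_pred0 => [|J]; last first.
  by apply/negbTE; rewrite neq_ltn (ltn_addr _ lt_ni) orbT.
by case: i lt_ni {coefJ} => // i lt_ni; rewrite -opprB subzn 1?ltnW // subSn.
Qed.

(** Where the shift runs below degree [0], the index exceeds [n] and [sigma]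
    vanishes, so the formula holds for every [k]. *)
Lemma coef_XnM_prodXD (R : realType) (n m k : nat) (y : 'I_n -> R) :
  ('X^m * \prod_(j < n) ('X + (y j)%:P))`_k = sigma ((n + m)%:Z - k%:Z) y.
Proof.
rewrite coefXnM; case: ltnP => [lt_km | le_mk].
  rewrite subzn; last by rewrite (leq_trans (ltnW lt_km)) ?leq_addl.
  by rewrite /= mesym_geqnE ?meval0 // ltn_subRL addnC ltn_add2l.
by rewrite coef_prodXD -subzn // PoszD; congr (sigma _ y); ring.
Qed.

Lemma big_lift (T : Type) (idx : T) (op : Monoid.com_law idx) (n : nat)
    (l : 'I_n) (F : 'I_n -> T) :
  \big[op/idx]_(j < n | j != l) F j = \big[op/idx]_(i < n.-1) F (lift l i).
Proof.
rewrite big_mkcond (bigD1_ord l) //= eqxx Monoid.mul1m.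
by apply: eq_bigr => i _; rewrite eq_sym neq_lift.
Qed.

Lemma comp_factor (R : realType) (N : nat) (x : 'I_N -> R) (j : 'I_N) :
  x j != 0 ->
  (1 - x j *: 'X) \Po (1 - 'X) = (x j)%:P * ('X + (shifted_inv x j)%:P).
Proof.
move=> xj0; rewrite comp_polyB comp_polyZ comp_polyX -polyC1 comp_polyC.
rewrite mulrDr -polyCM /shifted_inv [x j * _]mulrC divfK // -mul_polyC.
by rewrite polyCB polyC1; ring.
Qed.

Lemma comp_prod_factor (R : realType) (N : nat) (x : 'I_N -> R)
    (P : pred 'I_N) :
  (forall j, x j != 0) ->
  (\prod_(j < N | P j) (1 - x j *: 'X)) \Po (1 - 'X)
  = (\prod_(j < N | P j) x j)%:P
    * \prod_(j < N | P j) ('X + (shifted_inv x j)%:P).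
Proof.
move=> x0; rewrite [LHS]rmorph_prod rmorph_prod -big_split /=.
by apply: eq_bigr => j _; rewrite comp_factor.
Qed.

(** [W] as a polynomial in [u = 1 - t].  The common factor [P = \prod_j x j]
    comes out of the last sum too, by [P = x l * \prod_(j != l) x j]. *)
Lemma Wpoly_comp (R : realType) (N : nat) (b1 b2 : R) (a x : 'I_N -> R) :
  (forall j, x j != 0) ->
  let Q := \prod_(j < N) ('X + (shifted_inv x j)%:P) in
  let Ql l := \prod_(i < N.-1) ('X + (shifted_inv x (lift l i))%:P) in
  Wpoly b1 b2 a x \Po (1 - 'X)
  = (\prod_(j < N) x j) *:
      ((b1 + 1) *: ('X^1 * Q) + (b2 + 1) *: ('X^1 * Q - 'X^0 * Q)
       + \sum_(l < N) (a l + 1) *: ('X^2 * Ql l - 'X^1 * Ql l)).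
Proof.
move=> x0 Q Ql; rewrite /Wpoly.
have compX : (1 - 'X) \Po (1 - 'X) = 'X :> {poly R}.
  by rewrite comp_polyB comp_polyX -polyC1 comp_polyC opprB addrC subrK.
rewrite !comp_polyB !comp_polyZ !comp_polyM compX comp_polyX.
rewrite comp_prod_factor // -/Q [(\sum_(_ < _) _) \Po _]raddf_sum /=.
rewrite !scalerDr scaler_sumr -sumrN; congr (_ + _).
  by rewrite -!mul_polyC; ring.
apply: eq_bigr => l _; rewrite comp_polyZ !comp_polyM compX comp_polyX.
rewrite comp_prod_factor // (bigD1 l (P := xpredT)) //= !big_lift -/(Ql l).
by rewrite -!mul_polyC !polyCM; ring.
Qed.

Theorem lemma4p7 (R : realType) (N : nat) (b1 b2 : R) (a x : 'I_N -> R)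
    (hN : (1 <= N)%N) (hx : forall j : 'I_N, x j != 0)
    (e : 'I_N.+2 -> R)
    (he : Wpoly b1 b2 a x = \sum_(k < N.+2) e k *: (1 - 'X) ^+ k)
    (k : 'I_N.+2) :
  e k = (\prod_(j < N) x j) *
        ((b1 + 1) * v1 x k + (b2 + 1) * w1 x k
         + \sum_(l < N) (a l + 1) * z1 x k l).
Proof.
have -> : e k = (Wpoly b1 b2 a x \Po (1 - 'X))`_k.
  rewrite he [(\sum_(_ < _) _) \Po _]raddf_sum coef_sum (bigD1 k) //=.
  have compXn i : (1 - 'X) ^+ i \Po (1 - 'X) = 'X^i :> {poly R}.
    rewrite [LHS]rmorphXn /= comp_polyB comp_polyX -polyC1 comp_polyC.
    by rewrite opprB addrC subrK.
  rewrite comp_polyZ compXn coefZ coefXn eqxx mulr1 big1 ?addr0 // => i.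
  rewrite -val_eqE eq_sym => /negbTE ne_ki.
  by rewrite comp_polyZ compXn coefZ coefXn ne_ki mulr0.
rewrite Wpoly_comp // coefZ !coefD coefZ coefZ coefB !coef_XnM_prodXD coef_sum.
rewrite addn0 PoszD; congr (_ * (_ + _)); apply: eq_bigr => l _.
rewrite coefZ coefB !coef_XnM_prodXD.
(* [1 <= N] turns the indices [N.-1 + 2] and [N.-1 + 1], which come from the
   [N.-1] factors [j != l], into [N + 1] and [N]. *)
by rewrite addn2 addn1 prednK // (_ : N.+1%:Z = N%:Z + 1) // -addn1 PoszD.
Qed.
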